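(* Let $p>3$ be a prime, $q=p^n$ with $n\in\mathbb N$, and let $\mathbb P^1=\{(\xi,\tau)\in\mathbb F_q\times\mathbb F_q:\tau=\xi^2\}\subset\mathbb F_q^2$ be equipped with its normalized surface measure $\sigma$. Then $$\mathbf R^*_{\mathbb P^1}(2\to6)=(1+q^{-1}-q^{-2})^{1/6}.$$ In other words, the inequality $$\|(f\sigma)^\vee\|_{L^6(\mathbb F_q^2,\mathrm d\boldsymbol x)}^6\le\left(1+\frac1q-\frac1{q^2}\right)\|f\|_{L^2(\mathbb P^1,\mathrm d\sigma)}^6$$ holds for all $f:\mathbb P^1\to\mathbb C$ and is sharp (the constant is best possible), and equality holds if $f:\mathbb P^1\to\mathbb C$ is a constant function. Moreover, any maximizer $f$ of this inequality has constant modulus, i.e. $|f|$ is constant on $\mathbb P^1$.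
   Context: $\mathbb F_q$ is the finite field with $q$ elements and $e:\mathbb F_q\to\mathbb S^1\subset\mathbb C$ is a fixed nontrivial additive character. For $\boldsymbol x,\boldsymbol\xi\in\mathbb F_q^d$, $\boldsymbol x\cdot\boldsymbol\xi=\sum_i x_i\xi_i$. For a nonempty set $S\subset\mathbb F_q^d$ (frequency space $\mathbb F_q^{d*}$ is identified with $\mathbb F_q^d$) with normalized surface measure $\sigma$ (uniform probability measure on $S$) and $f:S\to\mathbb C$, the extension operator is $$(f\sigma)^\vee(\boldsymbol x)=\frac1{|S|}\sum_{\boldsymbol\xi\in S}f(\boldsymbol\xi)e(\boldsymbol x\cdot\boldsymbol\xi),\quad \boldsymbol x\in\mathbb F_q^d.$$ Norms: $\|f\|_{L^r(S,\mathrm d\sigma)}=\big(\frac1{|S|}\sum_{\boldsymbol\xi\in S}|f(\boldsymbol\xi)|^r\big)^{1/r}$ and $\|g\|_{L^r(\mathbb F_q^d,\mathrm d\boldsymbol x)}=\big(\sum_{\boldsymbol x\in\mathbb F_q^d}|g(\boldsymbol x)|^r\big)^{1/r}$ (counting measure). $\mathbf R^*_S(r\to s)$ denotes the best (smallest) constant for which $\|(f\sigma)^\vee\|_{L^s(\mathbb F_q^d,\mathrm d\boldsymbol x)}\le\mathbf R^*_S(r\to s)\|f\|_{L^r(S,\mathrm d\sigma)}$ holds for all $f:S\to\mathbb C$. A maximizer is a not identically zero function $f:S\to\mathbb C$ for which equality holds in the inequality with best constant. *)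

(* Defs.v *)
From mathcomp Require Import all_boot all_order all_algebra.
From mathcomp Require Import complex.
From mathcomp Require Import classical_sets reals exp.

Set Implicit Arguments.
Unset Strict Implicit.
Unset Printing Implicit Defensive.

Import Order.TTheory GRing.Theory Num.Theory.

Local Open Scope ring_scope.

(* The R-valued modulus; `|z| on R[i] is itself R[i]-valued. *)
Notation cmod := Normc.normc.

Definition nontrivial_add_char (R : realType) (F : finFieldType)
    (e : F -> R[i]) : Prop :=
  [/\ forall x y : F, e (x + y) = e x * e y,
      forall x : F, cmod (e x) = 1
    & exists x : F, e x != 1].

Definition dotp (F : finFieldType) (d : nat) (x xi : 'rV[F]_d) : F :=
  \sum_(i < d) x 0 i * xi 0 i.

(* Functions on S have as domain the subtype of the points of S. *)
Notation points S := {xi | xi \in S}.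

Section Extension.
Variables (R : realType) (F : finFieldType) (d : nat).
Variables (e : F -> R[i]) (S : {set 'rV[F]_d}).

Definition extension (f : points S -> R[i]) (x : 'rV[F]_d) : R[i] :=
  (#|S|%:R)^-1 * \sum_(xi : points S) f xi * e (dotp x (val xi)).

Definition norm_surface (r : R) (f : points S -> R[i]) : R :=
  ((#|S|%:R)^-1 * \sum_(xi : points S) cmod (f xi) `^ r) `^ r^-1.

Definition norm_counting (r : R) (g : 'rV[F]_d -> R[i]) : R :=
  (\sum_(x : 'rV[F]_d) cmod (g x) `^ r) `^ r^-1.

Definition extension_const (r s : R) : R :=
  inf [set C : R | forall f : points S -> R[i],
         norm_counting s (extension f) <= C * norm_surface r f]%classic.

Definition maximizer (r s : R) (f : points S -> R[i]) : Prop :=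
  (exists xi : points S, f xi != 0) /\
  norm_counting s (extension f) = extension_const r s * norm_surface r f.

End Extension.

Definition parabola (F : finFieldType) : {set 'rV[F]_2} :=
  [set v : 'rV[F]_2 | v 0 1 == v 0 0 ^+ 2]%SET.

(* Main.v *)
Require Import Defs.
From mathcomp Require Import all_boot all_order all_algebra.
From mathcomp Require Import complex.
From mathcomp Require Import classical_sets reals exp.
From mathcomp Require Import boolp finfield ring lra.

Set Implicit Arguments.
Unset Strict Implicit.
Unset Printing Implicit Defensive.

Import Order.TTheory GRing.Theory Num.Theory.

Local Open Scope ring_scope.

(** Expanding the cube of the extension and applying Plancherel, the sixth power
    of the [L^6] norm becomes a sum over pairs of triples [(a, b, c)] with equal
    sums and equal sums of squares.  Writing a triple as
    [(m + u, m + v, m - u - v)], the pairs share [m] and the value of the form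
    [u ^+ 2 + u * v + v ^+ 2].  A fibre over a nonzero value has at most [q + 1]
    points when [-3] is not a square and [q - 1] points when it is, so AM-GM
    handles those fibres; the zero fibre is the diagonal, joined in the split
    case by two lines through it, on which a Cauchy-Schwarz estimate makes up
    for the smaller fibres.  In both cases the energy is at most
    [(q + 1) * S ^+ 3 - q * \sum |f| ^+ 6] with [S = \sum |f| ^+ 2].  The power
    mean inequality [\sum |f| ^+ 6 >= S ^+ 3 / q ^+ 2] gives the constant, and
    its equality case the constant modulus of maximizers.  Constants attain
    equality because nondegenerate quadratic Gauss sums have modulus
    [sqrt q]. *)

(** * Cauchy-Schwarz for finite sums *)

Lemma sum_sqr_mul_le (R : realFieldType) (I : finType) (A : pred I) (a b : I -> R) :
  (\sum_(i | A i) a i * b i) ^+ 2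
    <= (\sum_(i | A i) a i ^+ 2) * (\sum_(i | A i) b i ^+ 2).
Proof.
(* Lagrange's identity: this double sum is twice the difference of the two sides. *)
have : 0 <= \sum_(i | A i) \sum_(j | A j) (a i * b j - a j * b i) ^+ 2.
  by apply: sumr_ge0 => i _; apply: sumr_ge0 => j _; apply: sqr_ge0.
have -> : \sum_(i | A i) \sum_(j | A j) (a i * b j - a j * b i) ^+ 2 =
  \sum_(i | A i) \sum_(j | A j) a i ^+ 2 * b j ^+ 2
  + \sum_(i | A i) \sum_(j | A j) b i ^+ 2 * a j ^+ 2
  - 2 * \sum_(i | A i) \sum_(j | A j) (a i * b i) * (a j * b j).
  rewrite mulr_sumr -big_split -sumrB /=; apply: eq_bigr => i _.
  rewrite mulr_sumr -big_split -sumrB /=; apply: eq_bigr => j _; ring.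
rewrite -!big_distrlr /=; nra.
Qed.

Lemma sqr_sum_le (R : realFieldType) (I : finType) (A : pred I) (a : I -> R) :
  (\sum_(i | A i) a i) ^+ 2 <= #|A|%:R * \sum_(i | A i) a i ^+ 2.
Proof.
have := sum_sqr_mul_le A (fun _ => 1) a.
under eq_bigr do rewrite mul1r.
by under [X in _ <= X * _]eq_bigr do rewrite expr1n; rewrite sumr_const.
Qed.

(** The form of discriminant [-3] left by centring: the squares of [m + u], [m + v] and [m - u - v]
    sum to [3 * m ^+ 2 + 2 * conic (u, v)]. *)
Definition conic (F : pzRingType) (P : F * F) : F :=
  P.1 ^+ 2 + P.1 * P.2 + P.2 ^+ 2.

(** * Fibres of the form over nonzero values *)

Section Conic.
Variable F : finFieldType.
Hypotheses (two_neq0 : 2 != 0 :> F) (three_neq0 : 3 != 0 :> F).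

(* Stereographic projection from [- P0]: with [X] and [Y] the polar form and
   the determinant of [P0] and [P], one has [X ^+ 2 + 3 * Y ^+ 2 = (2 k) ^+ 2]
   and [P] is sent to the slope [Y / (2 k + X)]. *)
Lemma card_conic_fiber (P0 : F * F) : conic P0 != 0 ->
  (#|[pred P | conic P == conic P0]|
     <= #|[pred m : F | (1 + 3 * m ^+ 2 != 0)%R]|.+1)%N.
Proof.
set k := conic P0 => k_neq0.
pose X (P : F * F) :=
  2 * P.1 * P0.1 + P.1 * P0.2 + P.2 * P0.1 + 2 * P.2 * P0.2.
pose Y (P : F * F) := P0.1 * P.2 - P.1 * P0.2.
have XY P : conic P = k -> X P ^+ 2 + 3 * Y P ^+ 2 = (2 * k) ^+ 2.
  move=> Pk; have -> : (2 * k) ^+ 2 = 4 * conic P * k by rewrite Pk; ring.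
  rewrite /X /Y /k /conic; ring.
(* [(X, Y)] is linear in [P] with determinant [2 * k]; [E1] and [E2] are Cramer's rule. *)
have XY_inj P P' : X P = X P' -> Y P = Y P' -> P = P'.
  move=> eX eY; have k2 : 2 * k != 0 by rewrite mulf_neq0.
  have E1 Z : 2 * k * Z.1 = P0.1 * X Z - (P0.1 + 2 * P0.2) * Y Z.
    rewrite /X /Y /k /conic; ring.
  have E2 Z : 2 * k * Z.2 = P0.2 * X Z + (2 * P0.1 + P0.2) * Y Z.
    rewrite /X /Y /k /conic; ring.
  have e1 : P.1 = P'.1 by apply: (mulfI k2); rewrite !E1 eX eY.
  have e2 : P.2 = P'.2 by apply: (mulfI k2); rewrite !E2 eX eY.
  by rewrite [P]surjective_pairing [P']surjective_pairing e1 e2.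
pose h P := if 2 * k + X P == 0 then None else Some (Y P / (2 * k + X P)).
have hP P : conic P = k -> forall m, h P = Some m ->
  [/\ 1 + 3 * m ^+ 2 != 0, (1 + 3 * m ^+ 2) * X P = 2 * k * (1 - 3 * m ^+ 2)
    & Y P = m * (2 * k + X P)].
  move=> /XY XYk m; rewrite /h; case: eqP => // /eqP d0 [<-].
  set m' := _ / _; have Ym : Y P = m' * (2 * k + X P) by rewrite /m' divfK.
  have /(mulfI d0) E : (2 * k + X P) * ((1 + 3 * m' ^+ 2) * (2 * k + X P))
      = (2 * k + X P) * (4 * k).
    transitivity ((2 * k + X P) ^+ 2 + 3 * Y P ^+ 2); first by rewrite Ym; ring.
    have -> : 3 * Y P ^+ 2 = (2 * k) ^+ 2 - X P ^+ 2 by rewrite -XYk; ring.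
    ring.
  split=> //.
    apply/eqP => E0; move/eqP: E; rewrite E0 mul0r eq_sym mulf_eq0 (negPf k_neq0).
    rewrite orbF (_ : 4 = 2 * 2 :> F); last by ring.
    by rewrite mulf_eq0 (negPf two_neq0).
  by move: E => /(congr1 (fun t => t - (1 + 3 * m' ^+ 2) * (2 * k))) E;
     transitivity (4 * k - (1 + 3 * m' ^+ 2) * (2 * k));
     [rewrite -E; ring | ring].
have hN P : conic P = k -> h P = None -> X P = - (2 * k) /\ Y P = 0.
  move=> /XY XYk; rewrite /h; case: eqP => // d0 _.
  have XE : X P = - (2 * k) by apply/eqP; rewrite -addr_eq0 addrC d0.
  split=> //; move/eqP: XYk; rewrite XE sqrrN -subr_eq0 addrAC subrr add0r.
  by rewrite mulf_eq0 (negPf three_neq0) sqrf_eq0 => /eqP.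
(* [None] comes only from the centre [- P0]. Slopes with [1 + 3 * m ^+ 2 = 0] are never reached,
   since [(1 + 3 * m ^+ 2) * (2 * k + X P) = 4 * k] is nonzero. *)
pose A := [set o : option F |
  if o is Some m then (1 + 3 * m ^+ 2 != 0)%R else true].
have cardA : #|A| = #|[pred m : F | (1 + 3 * m ^+ 2 != 0)%R]|.+1.
  have -> : A = None |: [set Some m | m in [pred m : F | (1 + 3 * m ^+ 2 != 0)%R]].
    apply/setP => -[m|]; rewrite !inE //=; apply/idP/imsetP.
      by move=> Am; exists m.
    by case=> m' + [->].
  rewrite cardsU1 card_imset; last by move=> ? ? [].
  by rewrite (_ : None \notin _) //; apply/imsetP => -[].
rewrite -cardA -(card_in_imset (f := h)); last first.
  move=> P P' /eqP Pk /eqP P'k hPP'; case E : (h P) => [m|].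
    have [m0 Xm Ym] := hP P Pk m E.
    have [_ Xm' Ym'] := hP P' P'k m (etrans (esym hPP') E).
    have eX : X P = X P' by apply: (mulfI m0); rewrite Xm Xm'.
    by apply: XY_inj => //; rewrite Ym Ym' eX.
  have [XE YE] := hN P Pk E; have [XE' YE'] := hN P' P'k (etrans (esym hPP') E).
  by apply: XY_inj; rewrite ?XE ?YE.
apply/subset_leq_card/fintype.subsetP => o /imsetP[P /eqP Pk ->].
by rewrite inE; case E : (h P) => [m|] //; have [] := hP P Pk m E.
Qed.

Lemma card_conic_fiber_nonsplit (P0 : F * F) : conic P0 != 0 ->
  (#|[pred P | conic P == conic P0]| <= #|F|.+1)%N.
Proof.
by move=> /card_conic_fiber/leq_trans; apply; rewrite ltnS max_card.
Qed.

(** [2 * z + 1] is a square root of [-3]; its inverse and the opposite of that inverse are two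
    distinct slopes to discard, which leaves [q - 2] slopes and the centre. *)
Lemma card_conic_fiber_split (z : F) (P0 : F * F) :
  z ^+ 2 + z + 1 = 0 -> conic P0 != 0 ->
  (#|[pred P | conic P == conic P0]| <= #|F|.-1)%N.
Proof.
move=> z0 /card_conic_fiber/leq_trans; apply.
have r2 : (2 * z + 1) ^+ 2 = - 3.
  by transitivity (4 * (z ^+ 2 + z + 1) - 3); [ring | rewrite z0; ring].
set r := 2 * z + 1 in r2.
have r0 : r != 0 by rewrite -sqrf_eq0 r2 oppr_eq0.
have rV : 1 + 3 * (r^-1) ^+ 2 = 0.
  by rewrite exprVn r2 invrN mulrN divff // subrr.
have : (#|[set r^-1; - r^-1]| + #|[pred m : F | (1 + 3 * m ^+ 2 != 0)%R]| <= #|F|)%N.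
  rewrite -(cardC [pred m : F | (1 + 3 * m ^+ 2 != 0)%R]) addnC leq_add2l.
  apply/subset_leq_card/fintype.subsetP => m; rewrite !inE negbK.
  by case/orP => /eqP ->; rewrite ?sqrrN rV.
have rN : r^-1 != - r^-1.
  rewrite -addr_eq0 (_ : r^-1 + r^-1 = 2 * r^-1); last by ring.
  by rewrite mulf_neq0 ?invr_eq0.
by rewrite cards2 rN /=; case: #|F|.
Qed.

End Conic.

(** * Energy of the fibres of a map, by AM-GM *)

Lemma fiber_energy_le (R : realFieldType) (I : finType) (K : eqType)
    (k : I -> K) (k0 : K) (c : nat) (W : I -> R) :
    (forall i, k i != k0 -> (#|[pred j | k j == k i]| <= c)%N) ->
  \sum_i \sum_(j | k j == k i) W i * W j
    <= c%:R * \sum_(i | k i != k0) W i ^+ 2 + (\sum_(i | k i == k0) W i) ^+ 2.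
Proof.
(* The fibre over [k0] stays an exact square, as [c] does not bound its size. *)
move=> kc; rewrite (bigID (fun i => k i == k0)) /= addrC; apply: lerD; last first.
  rewrite expr2 big_distrlr /=; apply: ler_sum => i /eqP ->.
  exact: lexx.
apply: (@le_trans _ _ (\sum_(i | k i != k0) \sum_(j | k j == k i) W i ^+ 2)); last first.
  rewrite mulr_sumr; apply: ler_sum => i ik.
  rewrite sumr_const -[_ *+ #|_|]mulr_natl ler_wpM2r ?sqr_ge0 //.
  by rewrite ler_nat kc.
(* Lying in the same fibre is a symmetric relation, so both halves of the AM-GM bound have the same
   total. *)
have sym : \sum_(i | k i != k0) \sum_(j | k j == k i) W j ^+ 2
         = \sum_(i | k i != k0) \sum_(j | k j == k i) W i ^+ 2.
  rewrite (exchange_big_dep (fun j => k j != k0)) /=; last first.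
    by move=> i j ik /eqP ->.
  apply: eq_bigr => i ik; apply: eq_bigl => j.
  by case: (eqVneq (k j) (k i)) => [->|]; rewrite ?ik ?andbF.
apply: (@le_trans _ _ (\sum_(i | k i != k0) \sum_(j | k j == k i)
    (W i ^+ 2 + W j ^+ 2) / 2)).
  apply: ler_sum => i _; apply: ler_sum => j _.
  have := sqr_ge0 (W i - W j); nra.
under eq_bigr do rewrite -mulr_suml big_split /=.
rewrite -mulr_suml big_split /= sym; lra.
Qed.

(** * The zero fibre of the form *)

Section ConicZeros.
Variable F : finFieldType.
Hypothesis three_neq0 : 3 != 0 :> F.

(** If [z = z ^+ 2] then [2 * z + 1 = 0], against [4 * (z ^+ 2 + z + 1) - (2 * z + 1) ^+ 2 = 3].
    This keeps the two lines of the split zero fibre distinct. *)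
Lemma cube_root_neq (z : F) : z ^+ 2 + z + 1 = 0 -> z != z ^+ 2.
Proof.
move=> z0; apply: contra_neq three_neq0 => zz.
have z1 : 2 * z + 1 = 0 by rewrite -z0 -zz; ring.
transitivity (4 * (z ^+ 2 + z + 1) - (2 * z + 1) ^+ 2); first by ring.
by rewrite z0 z1; ring.
Qed.

(** At a zero with [u != 0], the slope [v / u] would be a root of [z ^+ 2 + z + 1]. *)
Lemma sum_conic0_nonsplit (V : nmodType) (G : F * F -> V) :
    (forall z : F, z ^+ 2 + z + 1 != 0) ->
  \sum_(P | conic P == 0) G P = G (0, 0).
Proof.
move=> nz; rewrite (big_pred1 (0, 0)) // => -[u v] /=.
rewrite xpair_eqE /conic /=; apply/eqP/andP => [uv|[/eqP -> /eqP ->]]; last by ring.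
have [u0|u0] := eqVneq u 0.
  by move: uv; rewrite u0 mul0r expr0n /= !add0r => /eqP; rewrite sqrf_eq0.
have /negP[] := nz (v / u); apply/eqP; apply: (mulfI (expf_neq0 2 u0)).
rewrite mulr0 -uv; field => //.
Qed.

(** The form factors as [(v - z * u) * (v - z ^+ 2 * u)]: two lines that meet only at the origin,
    which is counted once. *)
Lemma sum_conic0_split (V : nmodType) (G : F * F -> V) (z : F) :
    z ^+ 2 + z + 1 = 0 ->
  \sum_(P | conic P == 0) G P
    = G (0, 0) + \sum_(u | u != 0) (G (u, z * u) + G (u, z ^+ 2 * u)).
Proof.
move=> z0.
have zz := cube_root_neq z0.
rewrite (eq_bigr (fun P => G (P.1, P.2))); last by case.
rewrite -(pair_big_dep xpredT (fun u v => conic (u, v) == 0) (fun u v => G (u, v))) /=.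
rewrite (bigD1 0) //=; congr (_ + _).
  rewrite (big_pred1 0) // => v.
  by rewrite /conic /= mul0r expr0n /= !add0r sqrf_eq0.
apply: eq_bigr => u u0.
have E v : (conic (u, v) == 0) = (v == z * u) || (v == z ^+ 2 * u).
  rewrite -(subr_eq0 v (z * u)) -(subr_eq0 v (z ^+ 2 * u)) -mulf_eq0.
  congr (_ == 0); rewrite /conic /=.
  transitivity (u ^+ 2 + u * v + v ^+ 2 + (z ^+ 2 + z + 1) * ((z - 1) * u ^+ 2 - u * v)).
    by rewrite z0; ring.
  by ring.
rewrite (eq_bigl _ _ E) (bigD1 (z * u)) ?eqxx //=; congr (_ + _).
rewrite (big_pred1 (z ^+ 2 * u)) // => v.
case: (eqVneq v (z * u)) => [->|] /=; last by rewrite andbT.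
by apply/esym/negbTE; apply: contra_neq zz => /(mulIf u0).
Qed.

End ConicZeros.

(** * Energy of centred triples *)

Definition centered_triple (F R : pzRingType) (g : F -> R) (m : F) (P : F * F) : R :=
  g (m + P.1) * g (m + P.2) * g (m - P.1 - P.2).

Section Triples.
Variable F : finFieldType.
Hypotheses (two_neq0 : 2 != 0 :> F) (three_neq0 : 3 != 0 :> F).

(** The centre [m] is recovered as a third of the sum of the entries, so the change of variables is
    a bijection. *)
Lemma sum_triples_centered (V : nmodType) (G : F -> F -> F -> V) :
  \sum_m \sum_(P : F * F) G (m + P.1) (m + P.2) (m - P.1 - P.2)
    = \sum_a \sum_b \sum_c G a b c.
Proof.
under [RHS]eq_bigr do rewrite pair_bigA.
rewrite !pair_bigA /=.
pose h (t : F * (F * F)) := (t.1 + t.2.1, (t.1 + t.2.2, t.1 - t.2.1 - t.2.2)).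
pose h' (t : F * (F * F)) := let m := (t.1 + t.2.1 + t.2.2) / 3 in
  (m, (t.1 - m, t.2.1 - m)).
rewrite [RHS](reindex h) //; apply: onW_bij; exists h' => -[a [b c]];
  rewrite /h /h' /=; congr (_, (_, _)); field => //.
Qed.

(** Cauchy-Schwarz in [u] separates the first factor from the other two. The first gives [S] for
    every [m]; the others give [S ^+ 2] after summing over [m], because [(m, u)] is determined by
    [(m + z * u, m + z ^+ 2 * u)]. *)
Lemma sum_lines_le (R : realFieldType) (g : F -> R) (z : F) :
    z ^+ 2 + z + 1 = 0 ->
  \sum_m (\sum_u g (m + u) * g (m + z * u) * g (m + z ^+ 2 * u)) ^+ 2
    <= (\sum_a g a ^+ 2) ^+ 3.
Proof.
move=> z0; set S := \sum_a g a ^+ 2.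
have zz : z ^+ 2 - z != 0 by rewrite subr_eq0 eq_sym cube_root_neq.
have -> : S ^+ 3 = \sum_m S * \sum_u g (m + z * u) ^+ 2 * g (m + z ^+ 2 * u) ^+ 2.
  rewrite -mulr_sumr exprS; congr (_ * _).
  rewrite expr2 big_distrlr /= !pair_bigA /=.
  pose h (t : F * F) := (t.1 + z * t.2, t.1 + z ^+ 2 * t.2).
  pose h' (t : F * F) := let u := (t.2 - t.1) / (z ^+ 2 - z) in
    (t.1 - z * u, u).
  rewrite [LHS](reindex h) //; apply: onW_bij; exists h' => -[a b];
    rewrite /h /h' /=; congr (_, _); field => //.
apply: ler_sum => m _.
under eq_bigr do rewrite -mulrA.
apply: le_trans (sum_sqr_mul_le _ _ _) _.
under [X in _ * X <= _]eq_bigr do rewrite exprMn.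
by rewrite (_ : \sum_i g (m + i) ^+ 2 = S) // /S [RHS](reindex_inj (addrI m)).
Qed.

(** In the split case the fibre bound [q - 1] falls short of [q + 1] by [2 * S ^+ 3], exactly what
    the line sums [2 * T m ^+ 2] may cost. Otherwise the zero fibre is one point, counted once
    instead of [q + 1] times, whence the term [- q * g m ^+ 6]. *)
Lemma triple_energy_le (R : realFieldType) (g : F -> R) :
  \sum_m \sum_P \sum_(P' | conic P' == conic P)
      centered_triple g m P * centered_triple g m P'
    <= (#|F|%:R + 1) * (\sum_a g a ^+ 2) ^+ 3 - #|F|%:R * \sum_a g a ^+ 6.
Proof.
set W := centered_triple g; set q := #|F|%:R; set S := \sum_a g a ^+ 2.
have WS : \sum_m \sum_P W m P ^+ 2 = S ^+ 3.
  rewrite (sum_triples_centered (fun a b c => (g a * g b * g c) ^+ 2)).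
  rewrite exprS expr2 !big_distrlr /=; apply: eq_bigr => a _.
  apply: eq_bigr => b _; rewrite big_distrr /=.
  by apply: eq_bigr => c _; ring.
have W0 m : W m (0, 0) = g m ^+ 3.
  by rewrite /W /centered_triple /= !subr0 addr0 !exprS expr0; ring.
have split0 m : \sum_(P | conic P != 0) W m P ^+ 2
    = \sum_P W m P ^+ 2 - \sum_(P | conic P == 0) W m P ^+ 2.
  by rewrite [in RHS](bigID (fun P => conic P == 0)) /= addrAC subrr add0r.
have sum6 : \sum_m g m ^+ 6 = \sum_m (g m ^+ 3) ^+ 2.
  by apply: eq_bigr => m _; rewrite -exprM.
have [/existsP[z /eqP z0] | /existsPn nz] :=
    boolP [exists z : F, z ^+ 2 + z + 1 == 0].
  have q1 : #|F|.-1%:R = q - 1 :> R.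
    have q_gt0 : (0 < #|F|)%N by apply/card_gt0P; exists 0.
    by rewrite /q -[in RHS](prednK q_gt0) -natr1 addrK.
  pose T m := \sum_u g (m + u) * g (m + z * u) * g (m + z ^+ 2 * u).
  apply: (@le_trans _ _ (\sum_m ((q - 1) * \sum_P W m P ^+ 2
      + 2 * T m ^+ 2 - q * (g m ^+ 3) ^+ 2))); last first.
    rewrite sumrB big_split /= -!mulr_sumr WS -sum6 lerD2r.
    by have := sum_lines_le g z0; rewrite -/S /T; lra.
  apply: ler_sum => m _.
  have /le_trans := fiber_energy_le (k := @conic F) (k0 := 0) (W m)
    (fun P => @card_conic_fiber_split F two_neq0 three_neq0 z P z0).
  apply.
  rewrite q1 split0 !(sum_conic0_split three_neq0 _ z0) W0.
  have z2 : z ^+ 2 = - z - 1 by apply/eqP; rewrite -subr_eq0 -z0; apply/eqP; ring.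
  (* The two lines are exchanged by swapping the last two entries of the triple, so they carry equal
     values. *)
  have Wz u : W m (u, z ^+ 2 * u) = W m (u, z * u).
    have e1 : m - u - z ^+ 2 * u = m + z * u by rewrite z2; ring.
    have e2 : m - u - z * u = m + z ^+ 2 * u by rewrite z2; ring.
    by rewrite /W /centered_triple /= e1 e2 -!mulrA [g (m + z * u) * _]mulrC.
  under [\sum_(u | u != 0) _]eq_bigr do rewrite Wz.
  under [\sum_(u | u != 0) (W m (u, z * u) + _)]eq_bigr do rewrite Wz.
  rewrite !big_split /=.
  have -> : T m = \sum_(u | u != 0) W m (u, z * u) + g m ^+ 3.
    rewrite /T (bigD1 0) //= addrC !mulr0 addr0; congr (_ + _); last by ring.
    apply: eq_bigr => u _; rewrite /W /centered_triple /=; congr (_ * _ * g _).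
    by rewrite z2; ring.
  (* With [w] the value at the origin and [L] the sum over a punctured line, [(w + 2 * L) ^+ 2 = 2 *
     (w + L) ^+ 2 - w ^+ 2 + 2 * L ^+ 2]. The squares removed from the two lines absorb
     [2 * L ^+ 2]. *)
  have := sqr_sum_le (fun u : F => u != 0) (fun u => W m (u, z * u)).
  rewrite cardC1 q1; nra.
apply: (@le_trans _ _ (\sum_m ((q + 1) * \sum_P W m P ^+ 2
    - q * (g m ^+ 3) ^+ 2))); last first.
  by rewrite sumrB -!mulr_sumr WS -sum6.
apply: ler_sum => m _.
have /le_trans := fiber_energy_le (k := @conic F) (k0 := 0) (W m)
  (@card_conic_fiber_nonsplit F two_neq0 three_neq0).
apply.
rewrite -natr1 -/q split0 !(sum_conic0_nonsplit _ nz) W0; lra.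
Qed.

End Triples.

(** * Additive characters, Plancherel and Gauss sums *)

Section Character.
Variables (R : realType) (F : finFieldType) (e : F -> R[i]).
Hypothesis he : nontrivial_add_char e.

Lemma add_charD x y : e (x + y) = e x * e y.
Proof. by case: he. Qed.

Lemma norm_add_char x : `|e x| = 1.
Proof. by case: he => _ e1 _; rewrite [LHS](congr1 (real_complex R) (e1 x)). Qed.

Lemma add_char0 : e 0 = 1.
Proof.
have e0 : e 0 != 0 by rewrite -normr_eq0 norm_add_char oner_neq0.
by apply: (mulfI e0); rewrite -add_charD addr0 mulr1.
Qed.

Lemma conj_add_char x : (e x)^* = e (- x).
Proof.
have ex : e x != 0 by rewrite -normr_eq0 norm_add_char oner_neq0.
by apply: (mulfI ex); rewrite -normCK norm_add_char expr1n -add_charD subrr add_char0.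
Qed.

Lemma sum_add_char y : \sum_x e (x * y) = if y == 0 then #|F|%:R else 0.
Proof.
case: eqP => [->|/eqP y0].
  by under eq_bigr do rewrite mulr0 add_char0; rewrite sumr_const.
have [_ _ [z ez]] := he.
(* Translating [x] by [z / y] multiplies the sum by [e z], which differs from [1]; the sum must
   vanish. *)
have : e z * \sum_x e (x * y) = \sum_x e (x * y).
  rewrite mulr_sumr [RHS](reindex_inj (addrI (z / y))) /=.
  by apply: eq_bigr => x _; rewrite -add_charD mulrDl divfK.
move/eqP; rewrite -subr_eq0 -{2}[\sum_x _]mul1r -mulrBl mulf_eq0 subr_eq0.
by rewrite (negPf ez) => /eqP.
Qed.

(** Frequencies may repeat, so orthogonality keeps all pairs with the same frequency; this is what
    lets triples serve as indices. *)
Lemma plancherel (I : finType) (phi psi : I -> F) (w : I -> R[i]) :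
  \sum_x \sum_t `|\sum_i w i * e (x * phi i + t * psi i)| ^+ 2
    = #|F|%:R ^+ 2
      * \sum_i \sum_(j | (phi j == phi i) && (psi j == psi i)) w i * (w j)^*.
Proof.
transitivity (\sum_i \sum_j w i * (w j)^*
    * ((\sum_x e (x * (phi i - phi j))) * (\sum_t e (t * (psi i - psi j))))).
  transitivity (\sum_x \sum_t \sum_i \sum_j w i * (w j)^*
      * (e (x * (phi i - phi j)) * e (t * (psi i - psi j)))).
    apply: eq_bigr => x _; apply: eq_bigr => t _.
    rewrite normCK rmorph_sum big_distrlr /=.
    apply: eq_bigr => i _; apply: eq_bigr => j _.
    rewrite rmorphM /= conj_add_char mulrACA -!add_charD; congr (_ * e _); ring.
  under eq_bigr do rewrite exchange_big /=.
  rewrite exchange_big /=; apply: eq_bigr => i _.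
  under eq_bigr do rewrite exchange_big /=.
  rewrite exchange_big /=; apply: eq_bigr => j _.
  rewrite big_distrlr mulr_sumr /=; apply: eq_bigr => x _.
  by rewrite mulr_sumr.
rewrite mulr_sumr; apply: eq_bigr => i _.
rewrite mulr_sumr [RHS]big_mkcond /=; apply: eq_bigr => j _.
rewrite !sum_add_char !subr_eq0 [phi i == _]eq_sym [psi i == _]eq_sym.
by case: eqP => _; case: eqP => _ /=; rewrite ?(mul0r, mulr0) // mulrC expr2.
Qed.

(** The extension operator without its factor [1 / q], with the parabola parametrized by its first
    coordinate. *)
Definition parabola_sum (f : F -> R[i]) (x t : F) : R[i] :=
  \sum_a f a * e (x * a + t * a ^+ 2).

Hypotheses (two_neq0 : 2 != 0 :> F) (three_neq0 : 3 != 0 :> F).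

Lemma parabola_sum_cube f x t :
  parabola_sum f x t ^+ 3 = \sum_(T : F * (F * F))
    centered_triple f T.1 T.2
    * e (x * (3 * T.1) + t * (3 * T.1 ^+ 2 + 2 * conic T.2)).
Proof.
rewrite -(pair_bigA _ (fun m P => centered_triple f m P
  * e (x * (3 * m) + t * (3 * m ^+ 2 + 2 * conic P)))) /=.
pose G a b c := f a * f b * f c
  * e (x * (a + b + c) + t * (a ^+ 2 + b ^+ 2 + c ^+ 2)).
rewrite (_ : \sum_m _ =
    \sum_m \sum_(P : F * F) G (m + P.1) (m + P.2) (m - P.1 - P.2)); last first.
  apply: eq_bigr => m _; apply: eq_bigr => -[u v] _.
  rewrite /G /centered_triple /conic /=; congr (_ * e _); ring.
rewrite sum_triples_centered // exprS expr2 /parabola_sum !big_distrlr /=.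
apply: eq_bigr => a _; apply: eq_bigr => b _; rewrite mulr_sumr.
apply: eq_bigr => c _; rewrite /G.
transitivity (f a * f b * f c * (e (x * a + t * a ^+ 2)
  * e (x * b + t * b ^+ 2) * e (x * c + t * c ^+ 2))); first by ring.
by rewrite -!add_charD; congr (_ * e _); ring.
Qed.

(** Equal frequencies mean equal centres, as [3] is invertible, and then equal values of [conic], as
    [2] is. *)
Lemma sum_parabola_sum6 f :
  \sum_x \sum_t `|parabola_sum f x t| ^+ 6
    = #|F|%:R ^+ 2 * \sum_m \sum_P \sum_(P' | conic P' == conic P)
        centered_triple f m P * (centered_triple f m P')^*.
Proof.
transitivity (\sum_x \sum_t `|\sum_(T : F * (F * F)) centered_triple f T.1 T.2
    * e (x * (3 * T.1) + t * (3 * T.1 ^+ 2 + 2 * conic T.2))| ^+ 2).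
  apply: eq_bigr => x _; apply: eq_bigr => t _.
  by rewrite -parabola_sum_cube normrX -exprM.
rewrite plancherel; congr (_ * _).
rewrite pair_bigA /=; apply: eq_bigr => -[m P] _ /=.
rewrite (eq_bigl (fun T => (T.1 == m) && (conic T.2 == conic P))); last first.
  case=> m' P' /=; rewrite (inj_eq (mulfI three_neq0)).
  case: eqP => [->|//] /=.
  by rewrite (inj_eq (addrI _)) (inj_eq (mulfI two_neq0)).
rewrite -(pair_big (fun m' => m' == m) (fun P' => conic P' == conic P) (fun m' P' =>
  centered_triple f m P * (centered_triple f m' P')^*)) /=.
by rewrite big_pred1_eq.
Qed.

Lemma sum_cmod_parabola_sum6_le f :
  \sum_x \sum_t cmod (parabola_sum f x t) ^+ 6
    <= #|F|%:R ^+ 2 * ((#|F|%:R + 1) * (\sum_a cmod (f a) ^+ 2) ^+ 3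
                       - #|F|%:R * \sum_a cmod (f a) ^+ 6).
Proof.
have centered_cmod m P :
    cmod (centered_triple f m P) = centered_triple (fun a => cmod (f a)) m P.
  by rewrite /centered_triple !Normc.normcM.
apply: (@le_trans _ _ (#|F|%:R ^+ 2 * \sum_m \sum_P \sum_(P' | conic P' == conic P)
    cmod (centered_triple f m P) * cmod (centered_triple f m P'))); last first.
  rewrite ler_wpM2l ?exprn_ge0 //.
  under eq_bigr do under eq_bigr do under eq_bigr do rewrite !centered_cmod.
  exact: triple_energy_le.
rewrite -lecR rmorphM rmorph_sum /=.
have normE (z : R[i]) : (cmod z)%:C%C = `|z| by [].
under eq_bigr do rewrite rmorph_sum /=.
under eq_bigr do under eq_bigr do rewrite rmorphXn /= normE.
(* A sum of sixth powers is its own modulus, so the triangle inequality applies to the energy it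
   equals and discards the phases. *)
have h0 : 0 <= \sum_x \sum_t `|parabola_sum f x t| ^+ 6.
  by apply: sumr_ge0 => x _; apply: sumr_ge0 => t _; apply: exprn_ge0.
rewrite -(ger0_norm h0) sum_parabola_sum6 normrM normrX normr_nat rmorphXn rmorph_nat.
rewrite ler_wpM2l ?exprn_ge0 // rmorph_sum /=.
apply: le_trans (ler_norm_sum _ _ _) _; apply: ler_sum => m _.
rewrite rmorph_sum; apply: le_trans (ler_norm_sum _ _ _) _; apply: ler_sum => P _.
rewrite rmorph_sum; apply: le_trans (ler_norm_sum _ _ _) _; apply: ler_sum => P' _.
by rewrite normrM norm_conjC rmorphM.
Qed.

(** Writing one variable of the squared sum as [b + h], the sum over [b] runs over the character at
    [2 * t * h] and kills every [h != 0]. *)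
Lemma norm_gauss_sum x t : t != 0 ->
  `|\sum_a e (x * a + t * a ^+ 2)| ^+ 2 = #|F|%:R.
Proof.
move=> t0; rewrite normCK rmorph_sum big_distrlr /= exchange_big /=.
transitivity (\sum_b \sum_h e (x * h + t * h ^+ 2) * e (b * (2 * t * h))).
  apply: eq_bigr => b _; rewrite (reindex_inj (addrI b)) /=.
  apply: eq_bigr => h _; rewrite conj_add_char -!add_charD; congr (e _); ring.
rewrite exchange_big (bigD1 0) //= [X in _ + X]big1 => [|h h0]; last first.
  rewrite -mulr_sumr sum_add_char -mulrA !mulf_eq0.
  by rewrite (negPf two_neq0) (negPf t0) (negPf h0) mulr0.
rewrite -mulr_sumr sum_add_char !(mulr0, expr0n, addr0) /= eqxx.
by rewrite add_char0 mul1r.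
Qed.

(** The origin gives [q ^+ 6], the other points with [t = 0] give nothing, and each of the
    [q * (q - 1)] points with [t != 0] gives [q ^+ 3]. *)
Lemma sum_cmod_gauss_sum6 (c : R[i]) :
  \sum_x \sum_t cmod (parabola_sum (fun=> c) x t) ^+ 6
    = cmod c ^+ 6 * (#|F|%:R ^+ 6 + #|F|%:R ^+ 5 - #|F|%:R ^+ 4).
Proof.
have q_gt0 : (0 < #|F|)%N by apply/card_gt0P; exists 0.
set q := #|F|%:R.
have normE (z : R[i]) : (cmod z)%:C%C = `|z| by [].
have cE x t : cmod (parabola_sum (fun=> c) x t) =
    cmod c * cmod (\sum_a e (x * a + t * a ^+ 2)).
  by rewrite /parabola_sum -mulr_sumr Normc.normcM.
under eq_bigr do under eq_bigr do rewrite cE exprMn.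
under eq_bigr do rewrite -mulr_sumr.
rewrite -mulr_sumr; congr (_ * _).
rewrite exchange_big (bigD1 0) //= (bigD1 0) //= [X in _ + X + _ = _]big1 => [|x x0].
  rewrite (eq_bigr (fun _ => q * q ^+ 3)) => [|t t0].
    rewrite sumr_const cardC1 -[_ *+ _.-1]mulr_natl.
    have -> : #|F|.-1%:R = q - 1.
      by rewrite /q -[in RHS](prednK q_gt0) -natr1 addrK.
    under eq_bigr do rewrite !mul0r addr0 add_char0.
    rewrite sumr_const (_ : cmod _ = q); last first.
      by apply: (@complexI R); rewrite normE normr_nat rmorph_nat.
    ring.
  rewrite (eq_bigr (fun _ => q ^+ 3)) => [|x _].
    by rewrite sumr_const -[_ *+ _]mulr_natl.
  apply: (@complexI R); rewrite -[6%N]/(2 * 3)%N exprM !rmorphXn /= normE.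
  by rewrite norm_gauss_sum // rmorph_nat.
under eq_bigr do rewrite mul0r addr0 mulrC.
by rewrite sum_add_char (negPf x0) Normc.normc0 expr0n.
Qed.

End Character.

(** * The power mean inequality with its remainder *)

Lemma sum_cube_sub_mean (R : realFieldType) (I : finType) (a : I -> R) (mu : R) :
    \sum_i a i = #|I|%:R * mu ->
  \sum_i a i ^+ 3 - #|I|%:R * mu ^+ 3
    = \sum_i (a i - mu) ^+ 2 * (a i + 2 * mu).
Proof.
move=> aE.
(* Each term loses the tangent of the cube at [mu]; as [mu] is the mean, these tangents total
   [#|I|%:R * mu ^+ 3]. *)
transitivity (\sum_i (a i ^+ 3 + (- 3 * mu ^+ 2 * a i + 2 * mu ^+ 3))).
  rewrite !big_split /= -mulr_sumr aE sumr_const -[_ *+ _]mulr_natl; ring.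
by apply: eq_bigr => i _; ring.
Qed.

Lemma tangent_gap_ge0 (R : realFieldType) (x mu : R) :
  0 <= mu -> 0 <= (x ^+ 2 - mu) ^+ 2 * (x ^+ 2 + 2 * mu).
Proof. by move=> mu0; rewrite mulr_ge0 ?addr_ge0 ?sqr_ge0 ?mulr_ge0. Qed.

Lemma cmod_ge0 (R : realType) (z : R[i]) : 0 <= cmod z.
Proof. by case: z => x y; apply: sqrtr_ge0. Qed.

Lemma powR_natK (R : realType) (a : R) (k : nat) : 0 <= a -> (0 < k)%N ->
  (a `^ k%:R^-1) ^+ k = a.
Proof.
move=> a0 k0; rewrite -powR_mulrn ?powR_ge0 // -powRrM mulVf ?powRr1 //.
by rewrite pnatr_eq0 -lt0n.
Qed.

(** * Coordinates on the plane and on the parabola *)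

Section Points.
Variable F : finFieldType.

Definition row2 (a b : F) : 'rV[F]_2 := \row_i (if i == 0 then a else b).

Lemma row2_eta (v : 'rV[F]_2) : row2 (v 0 0) (v 0 1) = v.
Proof.
apply/rowP => -[[|[|//]] i_lt]; rewrite mxE /=; congr (v _ _); exact/val_inj.
Qed.

Lemma sum_row2 (V : nmodType) (G : 'rV[F]_2 -> V) :
  \sum_x G x = \sum_a \sum_b G (row2 a b).
Proof.
rewrite pair_bigA /= (reindex (fun p : F * F => row2 p.1 p.2)) //.
apply: onW_bij; exists (fun v : 'rV[F]_2 => (v 0 0, v 0 1)) => [[a b]|v] /=.
  by rewrite !mxE.
exact: row2_eta.
Qed.

Lemma dotp_row2 a b c d : dotp (row2 a b) (row2 c d) = a * c + b * d.
Proof. by rewrite /dotp !big_ord_recl big_ord0 addr0 !mxE. Qed.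

Lemma row2_parabola a : row2 a (a ^+ 2) \in parabola F.
Proof. by rewrite inE !mxE. Qed.

Definition parabola_point a : points (parabola F) :=
  exist _ (row2 a (a ^+ 2)) (row2_parabola a).

Lemma parabola_pointK (xi : points (parabola F)) :
  parabola_point (val xi 0 0) = xi.
Proof.
have := valP xi; rewrite inE => /eqP xiP.
by apply/val_inj; rewrite /= -xiP row2_eta.
Qed.

Lemma parabola_point_bij : bijective parabola_point.
Proof.
exists (fun xi : points (parabola F) => val xi 0 0); last exact: parabola_pointK.
by move=> a; rewrite /= mxE.
Qed.

Lemma card_parabola : #|parabola F| = #|F|.
Proof. by rewrite (bij_eq_card parabola_point_bij) card_sig; apply: eq_card. Qed.

End Points.

(** * The two norms in coordinates *)

Section Norms.
Variables (R : realType) (F : finFieldType) (e : F -> R[i]).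
Notation q := (#|F|%:R : R).
Implicit Type f : points (parabola F) -> R[i].

Lemma card_field_gt0 : 0 < q.
Proof. by rewrite ltr0n; apply/card_gt0P; exists 0. Qed.

Lemma norm_surface_exp6 f :
  norm_surface 2 f ^+ 6
    = (q^-1 * \sum_a cmod (f (parabola_point a)) ^+ 2) ^+ 3.
Proof.
rewrite /norm_surface -[6%N]/(2 * 3)%N exprM powR_natK //; last first.
  by apply: mulr_ge0; [rewrite invr_ge0 | apply: sumr_ge0 => xi _; apply: powR_ge0].
rewrite card_parabola (reindex _ (onW_bij _ (parabola_point_bij F))) /=.
under eq_bigr => a _ do [rewrite powR_mulrn; last exact: cmod_ge0].
by [].
Qed.

Lemma norm_counting_exp6 f :
  norm_counting 6 (extension e f) ^+ 6
    = q ^- 6 * \sum_x \sum_t cmod (parabola_sum e (f \o @parabola_point F) x t) ^+ 6.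
Proof.
rewrite /norm_counting powR_natK //; last first.
  by apply: sumr_ge0 => x _; apply: powR_ge0.
rewrite sum_row2 mulr_sumr; apply: eq_bigr => x _.
rewrite mulr_sumr; apply: eq_bigr => t _.
rewrite powR_mulrn ?cmod_ge0 // /extension card_parabola.
rewrite (reindex _ (onW_bij _ (parabola_point_bij F))) /=.
rewrite Normc.normcM exprMn; congr (_ * _ ^+ 6).
  rewrite Normc.normcV exprVn; congr (_ ^- 6).
  apply: (@complexI R); rewrite rmorph_nat; exact: normr_nat.
congr cmod; apply: eq_bigr => a _; congr (_ * e _).
exact: dotp_row2.
Qed.

End Norms.

(** * The sharp constant and the maximizers *)

Section Sharp.
Variables (R : realType) (F : finFieldType) (e : F -> R[i]).
Hypothesis he : nontrivial_add_char e.
Hypotheses (two_neq0 : 2 != 0 :> F) (three_neq0 : 3 != 0 :> F).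
Notation q := (#|F|%:R : R).
Let K := 1 + q^-1 - q ^- 2.
Implicit Type f : points (parabola F) -> R[i].

Let q_neq0 : q != 0. Proof. by rewrite gt_eqF // card_field_gt0. Qed.

(* The deficit is a sum of nonnegative terms because [a ^+ 3] lies above its
   tangent at the mean of the values [a = |f| ^+ 2]. *)
Lemma extension_deficit f (mu : R) : mu = norm_surface 2 f ^+ 2 ->
  norm_counting 6 (extension e f) ^+ 6
    + q ^- 3 * \sum_a (cmod (f (parabola_point a)) ^+ 2 - mu) ^+ 2
                      * (cmod (f (parabola_point a)) ^+ 2 + 2 * mu)
    <= K * norm_surface 2 f ^+ 6.
Proof.
move=> muN; pose g a := cmod (f (parabola_point a)).
have muE : \sum_a g a ^+ 2 = q * mu.
  rewrite muN /norm_surface powR_natK //; last first.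
    by apply: mulr_ge0; [rewrite invr_ge0 | apply: sumr_ge0 => xi _; apply: powR_ge0].
  rewrite card_parabola (reindex _ (onW_bij _ (parabola_point_bij F))) /=.
  rewrite mulVKf //.
  by apply: eq_bigr => a _; rewrite powR_mulrn ?cmod_ge0.
have := sum_cmod_parabola_sum6_le he two_neq0 three_neq0 (f \o @parabola_point F).
(* The remainder has weight [q ^- 3]: [q ^- 6] from normalization, [q ^+ 2] from Plancherel, [q]
   from the energy bound. *)
rewrite -(sum_cube_sub_mean muE) norm_counting_exp6 muE.
have -> : norm_surface 2 f ^+ 6 = mu ^+ 3 by rewrite muN -exprM.
set E := \sum_x _; under eq_bigr do rewrite -[6%N]/(2 * 3)%N exprM.
set G := (X in _ - _ * X); set G' := \sum_i _; have -> : G' = G by [].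
move=> EG.
have q6 : 0 <= q ^- 6 by rewrite invr_ge0 exprn_ge0.
have := ler_wpM2l q6 EG; rewrite -subr_ge0 => h; rewrite -subr_ge0.
apply: le_trans h _; rewrite le_eqVlt; apply/orP; left; apply/eqP.
by rewrite /K; field.
Qed.

Lemma extension_le f :
  norm_counting 6 (extension e f) ^+ 6 <= K * norm_surface 2 f ^+ 6.
Proof.
apply: le_trans (extension_deficit (erefl (norm_surface 2 f ^+ 2))).
rewrite lerDl mulr_ge0 ?invr_ge0 ?exprn_ge0 // sumr_ge0 // => a _.
by rewrite tangent_gap_ge0 ?sqr_ge0.
Qed.

Lemma extension_cst f (c : R[i]) : (forall xi, f xi = c) ->
  norm_counting 6 (extension e f) ^+ 6 = K * norm_surface 2 f ^+ 6.
Proof.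
move=> fc; rewrite norm_counting_exp6 norm_surface_exp6.
under [in RHS]eq_bigr do rewrite fc.
have -> : f \o @parabola_point F = fun=> c.
  by apply: funext => a; apply: fc.
rewrite sum_cmod_gauss_sum6 // sumr_const -[_ *+ _]mulr_natl /K.
by field.
Qed.

(** Supplies the nonnegativity of [K] needed to take its sixth root. *)
Lemma sharp_const_ge1 : 1 <= K.
Proof.
rewrite /K -addrA lerDl subr_ge0 -exprVn expr2 ler_piMl ?invr_ge0 //.
by rewrite invf_le1 ?card_field_gt0 // ler1n -(ltr0n R) card_field_gt0.
Qed.

Lemma norm_surface_cst1 : norm_surface 2 (fun _ : points (parabola F) => 1 : R[i]) = 1.
Proof.
rewrite /norm_surface; under eq_bigr do rewrite Normc.normc1 powR1.
rewrite sumr_const card_sig (eq_card (B := mem (parabola F))) //.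
by rewrite card_parabola mulVf ?powR1.
Qed.

Lemma sharp_const_le (C : R) :
  (forall f, norm_counting 6 (extension e f) ^+ 6 <= C * norm_surface 2 f ^+ 6) ->
  K <= C.
Proof.
move=> /(_ (fun=> 1)).
by rewrite (@extension_cst _ 1) // norm_surface_cst1 expr1n !mulr1.
Qed.

Lemma extension_constE : extension_const e (parabola F) 2 6 = K `^ 6^-1.
Proof.
have K0 : 0 <= K by apply: le_trans sharp_const_ge1.
have KK : (K `^ 6^-1) ^+ 6 = K by rewrite powR_natK.
have mem f : norm_counting 6 (extension e f) <= K `^ 6^-1 * norm_surface 2 f.
  rewrite -(@ler_pXn2r _ 6) ?nnegrE ?mulr_ge0 ?powR_ge0 //.
  by rewrite exprMn KK extension_le.
have lb C : (forall f, norm_counting 6 (extension e f) <= C * norm_surface 2 f) ->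
    K `^ 6^-1 <= C.
  move=> /(_ (fun=> 1)); rewrite norm_surface_cst1 mulr1; apply: le_trans.
  rewrite -(@ler_pXn2r _ 6) ?nnegrE ?powR_ge0 //.
  by rewrite KK (@extension_cst _ 1) // norm_surface_cst1 expr1n mulr1.
apply/eqP; rewrite eq_le; apply/andP; split.
  by apply: ge_inf => //; exists (K `^ 6^-1).
by apply: lb_le_inf => //; exists (K `^ 6^-1).
Qed.

(** Equality makes the deficit nonpositive; being a sum of nonnegative terms, it vanishes term by
    term. *)
Lemma maximizer_cmod f : maximizer e 2 6 f ->
  forall xi, cmod (f xi) = norm_surface 2 f.
Proof.
case=> _; rewrite extension_constE => fmax.
have K0 : 0 <= K by apply: le_trans sharp_const_ge1.
have NS0 : 0 <= norm_surface 2 f by apply: powR_ge0.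
have := extension_deficit (erefl (norm_surface 2 f ^+ 2)).
set mu := norm_surface 2 f ^+ 2; have mu0 : 0 <= mu by apply: exprn_ge0.
rewrite fmax exprMn powR_natK // gerDl pmulr_rle0; last first.
  by rewrite invr_gt0 exprn_gt0 // card_field_gt0.
set D := \sum_a _ => D0.
have Dge0 a : true -> 0 <= (cmod (f (parabola_point a)) ^+ 2 - mu) ^+ 2
    * (cmod (f (parabola_point a)) ^+ 2 + 2 * mu).
  by move=> _; apply: tangent_gap_ge0.
have /eqP : D = 0 by apply/eqP; rewrite eq_le D0 sumr_ge0.
rewrite psumr_eq0 // => /allP Da xi.
have := Da (val xi 0 0) (mem_index_enum _); rewrite parabola_pointK /=.
rewrite mulf_eq0 sqrf_eq0 subr_eq0 => h.
suff /eqP : cmod (f xi) ^+ 2 == mu.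
  by move/(congr1 Num.sqrt); rewrite !sqrtr_sqr !ger0_norm ?cmod_ge0.
(* If the second factor vanishes, then so do its nonnegative summands, and both sides are zero. *)
case/orP: h => // /eqP; have := sqr_ge0 (cmod (f xi)) => ? ?.
by apply/eqP; lra.
Qed.

End Sharp.

Lemma natr_neq0_card (F : finFieldType) (p n k : nat) :
    prime p -> #|F| = (p ^ n)%N -> (0 < k < p)%N -> k%:R != 0 :> F.
Proof.
move=> pp cF /andP[k0 kp].
by rewrite -(dvdn_pcharf (card_finPcharP cF pp)) gtnNdvd.
Qed.

Theorem theorem1p3 (R : realType) (p n : nat) (F : finFieldType)
    (hp : prime p) (hp3 : (3 < p)%N) (hn : (0 < n)%N)
    (hF : #|F| = (p ^ n)%N)
    (e : F -> R[i]) (he : nontrivial_add_char e) :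
  let q : R := (p ^ n)%N%:R in
  let P1 := parabola F in
  [/\ extension_const e P1 2 6 = (1 + q^-1 - q ^- 2) `^ 6^-1,
      forall f : points P1 -> R[i],
        norm_counting 6 (extension e f) ^+ 6
          <= (1 + q^-1 - q ^- 2) * norm_surface 2 f ^+ 6,
      forall C : R,
        (forall f : points P1 -> R[i],
           norm_counting 6 (extension e f) ^+ 6
             <= C * norm_surface 2 f ^+ 6) ->
        1 + q^-1 - q ^- 2 <= C,
      forall f : points P1 -> R[i],
        (exists c : R[i], forall xi, f xi = c) ->
        norm_counting 6 (extension e f) ^+ 6
          = (1 + q^-1 - q ^- 2) * norm_surface 2 f ^+ 6
    & forall f : points P1 -> R[i],
        maximizer e 2 6 f ->
        exists m : R, forall xi : points P1, cmod (f xi) = m].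
Proof.
have two_neq0 : 2 != 0 :> F.
  by apply: (natr_neq0_card hp hF); rewrite (ltn_trans _ hp3).
have three_neq0 : 3 != 0 :> F by apply: (natr_neq0_card hp hF).
move=> q P1; rewrite /q -hF; split.
- exact: extension_constE.
- exact: extension_le.
- exact: sharp_const_le.
- by move=> f [c fc]; apply: extension_cst fc.
- move=> f fmax; exists (norm_surface 2 f); exact: (maximizer_cmod he).
Qed.
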